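(* Let $f,L,g$ be continuous and assume that there are constants $M_f,M_L,M_g,L_f,L_L,L_g$ such that for all $x,y\in\mathbb{R}^d$, $u\in U$, $s\in[0,T]$: (i) $|f(x,u,s)|\le M_f$, $|L(x,u,s)|\le M_L$, $|g(x)|\le M_g$; (ii) $|f(x,u,s)-f(y,u,s)|\le L_f|x-y|$ and $|L(x,u,s)-L(y,u,s)|\le L_L|x-y|$; (iii) $|g(x)-g(y)|\le L_g|x-y|$. Assume that the pruning tolerance satisfies $\varepsilon_{\mathcal T}\le C\Delta t^2$ for a constant $C$ independent of $\Delta t$. Let $V$ be the discrete value function and $V^P$ the pruned discrete value function. Then, for all $(x,t)\in\mathbb{R}^d\times[0,T]$, $$|V(x,t)-V^P(x,t)|\le C^*(T)\,\Delta t,$$ where $C^*(T)$ is a constant not depending on $\Delta t$.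
   Context: Fix $T>0$, $\lambda\ge 0$, integers $d,m\ge1$ and a finite set of controls $U=\{u_1,\dots,u_M\}\subset\mathbb{R}^m$. The data are $f:\mathbb{R}^d\times\mathbb{R}^m\times[0,T]\to\mathbb{R}^d$, $L:\mathbb{R}^d\times\mathbb{R}^m\times[0,T]\to\mathbb{R}$ (arguments: state, control, time) and $g:\mathbb{R}^d\to\mathbb{R}$. Time grid: $\Delta t=T/\overline N$, $t_n=n\Delta t$, $n=0,\dots,\overline N$. For an initial time $s\in[t_n,t_{n+1})$, $\mathcal{U}^\Delta$ is the set of controls $u=\sum_{k=n}^{\overline N-1}u^k\chi_{[t_k,t_{k+1})}$ with $u^k\in U$. Discrete value function: the Euler scheme from $(x,s)$ is $y^{n+1}=x+(t_{n+1}-s)f(x,u^n,s)$, $y^{k+1}=y^k+\Delta t f(y^k,u^k,t_k)$ for $k\ge n+1$; $$J^{\Delta t}_{x,s}(u)=(t_{n+1}-s)L(x,u^n,s)+\Delta t\sum_{k=n+1}^{\overline N-1}L(y^k,u^k,t_k)e^{-\lambda(t_k-s)}+g(y^{\overline N})e^{-\lambda(T-s)},$$ $V(x,s)=\inf_{u\in\mathcal{U}^\Delta}J^{\Delta t}_{x,s}(u)$, and $V(x,T)=g(x)$. Pruned discrete value function: for a tolerance $\varepsilon_{\mathcal T}>0$, a point $x$ and a finite family $\{x_i\}$ put $\mathcal{E}_{\varepsilon_{\mathcal T}}(x,\{x_i\})=x_k-x$ if $k\in\arg\min_i|x-x_i|$ and $|x-x_k|\le\varepsilon_{\mathcal T}$,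 and $\mathcal{E}_{\varepsilon_{\mathcal T}}(x,\{x_i\})=0$ otherwise; thus $|\mathcal{E}_{\varepsilon_{\mathcal T}}|\le\varepsilon_{\mathcal T}$. The pruned tree rooted at $(x,s)$ is built level by level: from each retained node $\eta^k$ of level $k$ and each control one computes the Euler step, and replaces the result $\zeta$ by $\zeta+\mathcal{E}_{\varepsilon_{\mathcal T}}(\zeta,\{\eta^{k+1}_i\}_i)$, where $\{\eta^{k+1}_i\}_i$ are the nodes of level $k+1$ already computed and retained (so a new node within $\varepsilon_{\mathcal T}$ of a retained one is merged with it). The pruned trajectory for $u\in\mathcal{U}^\Delta$ is therefore $\eta^{n+1}=x+(t_{n+1}-s)f(x,u^n,s)+\mathcal{E}_{\varepsilon_{\mathcal T}}(x+(t_{n+1}-s)f(x,u^n,s),\{\eta^{n+1}_i\}_i)$ and $\eta^{k+1}=\eta^k+\Delta t f(\eta^k,u^k,t_k)+\mathcal{E}_{\varepsilon_{\mathcal T}}(\eta^k+\Delta t f(\eta^k,u^k,t_k),\{\eta^{k+1}_i\}_i)$ for $k\ge n+1$. Then $$J^{\Delta t,P}_{x,s}(u)=(t_{n+1}-s)L(x,u^n,s)+\Delta t\sum_{k=n+1}^{\overline N-1}L(\eta^k,u^k,t_k)e^{-\lambda(t_k-s)}+g(\eta^{\overline N})e^{-\lambda(T-s)},$$ $V^P(x,s)=\inf_{u\in\mathcal{U}^\Delta}J^{\Delta t,P}_{x,s}(u)$, and $V^P(x,T)=g(x)$. *)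

(* Defs.v *)
From HB Require Import structures.
From mathcomp Require Import all_boot all_order all_algebra.
From mathcomp Require Import all_classical all_reals all_analysis.
Set Implicit Arguments.
Unset Strict Implicit.
Unset Printing Implicit Defensive.
Import Order.TTheory GRing.Theory Num.Theory.
Import numFieldNormedType.Exports.
Local Open Scope classical_set_scope.
Local Open Scope ring_scope.

(* The library norm on row vectors is the sup norm; |.| on R^d is Euclidean. *)
Definition enorm (R : realType) (d : nat) (x : 'rV[R]_d) : R :=
  Num.sqrt (\sum_(i < d) x 0 i ^+ 2).

Section Scheme.
Variables (R : realType) (d m : nat).
Variables (T lambda : R).
Variable f : 'rV[R]_d -> 'rV[R]_m -> R -> 'rV[R]_d.
Variable L : 'rV[R]_d -> 'rV[R]_m -> R -> R.
Variable g : 'rV[R]_d -> R.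
Variable U : set 'rV[R]_m.
Variable N : nat.

Definition time_step : R := T / N%:R.

Definition grid (n : nat) : R := n%:R * time_step.

Definition grid_index (s : R) : nat := Num.truncn (s / time_step).

Lemma grid_indexP (s : R) : 0 < time_step -> 0 <= s ->
  grid (grid_index s) <= s < grid (grid_index s).+1.
Proof.
move=> dt0 s0; have /truncn_itv : 0 <= s / time_step by rewrite divr_ge0 // ltW.
by rewrite ler_pdivlMr // ltr_pdivrMr.
Qed.

(* A control sum_k u^k chi_[t_k, t_(k+1)[ with t_k >= t_n is encoded by its
   coefficients u^k, n <= k < N, where n = grid_index s; the other values of
   the sequence are never used. *)
Definition controls (s : R) : set (nat -> 'rV[R]_m) :=
  [set u | forall k, (grid_index s <= k < N)%N -> U (u k)].

Definition euler_step (s : R) (k : nat) (y : 'rV[R]_d) (v : 'rV[R]_m)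
    : 'rV[R]_d :=
  if k == grid_index s then y + (grid k.+1 - s) *: f y v s
  else y + time_step *: f y v (grid k).

Fixpoint iter_step (F : nat -> 'rV[R]_d -> 'rV[R]_m -> 'rV[R]_d) (n : nat)
    (x : 'rV[R]_d) (u : nat -> 'rV[R]_m) (j : nat) : 'rV[R]_d :=
  if j is i.+1 then F (n + i)%N (iter_step F n x u i) (u (n + i)%N) else x.

(* The trajectory is indexed by its level k >= grid_index s in the time grid,
   and its value at level grid_index s is x. *)
Definition trajectory (F : nat -> 'rV[R]_d -> 'rV[R]_m -> 'rV[R]_d)
    (x : 'rV[R]_d) (s : R) (u : nat -> 'rV[R]_m) (k : nat) : 'rV[R]_d :=
  iter_step F (grid_index s) x u (k - grid_index s).

Definition cost (x : 'rV[R]_d) (s : R) (y : nat -> 'rV[R]_d)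
    (u : nat -> 'rV[R]_m) : R :=
  let n := grid_index s in
  (grid n.+1 - s) * L x (u n) s
  + time_step * \sum_(n.+1 <= k < N)
      L (y k) (u k) (grid k) * expR (- lambda * (grid k - s))
  + g (y N) * expR (- lambda * (T - s)).

Definition value_along (F : nat -> 'rV[R]_d -> 'rV[R]_m -> 'rV[R]_d)
    (x : 'rV[R]_d) (s : R) : R :=
  if s == T then g x
  else inf [set cost x s (trajectory F x s u) u | u in controls s].

Definition value (x : 'rV[R]_d) (s : R) : R :=
  value_along (euler_step s) x s.

Definition is_argmin (x : 'rV[R]_d) (xs : seq 'rV[R]_d) (k : nat) : Prop :=
  (k < size xs)%N /\
  forall i, (i < size xs)%N -> enorm (x - xs`_k) <= enorm (x - xs`_i).

(* The values allowed for the correction E_eps(x, {x_i}), which is not unique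
   when several x_i are nearest to x. *)
Definition is_correction (eps : R) (x : 'rV[R]_d) (xs : seq 'rV[R]_d)
    (e : 'rV[R]_d) : Prop :=
  (exists k, [/\ is_argmin x xs k, enorm (x - xs`_k) <= eps & e = xs`_k - x])
  \/ ((~ exists k, is_argmin x xs k /\ enorm (x - xs`_k) <= eps) /\ e = 0).

Definition retained (S : 'rV[R]_d -> 'rV[R]_m -> 'rV[R]_d)
    (ps : seq ('rV[R]_d * 'rV[R]_m)) : seq 'rV[R]_d :=
  undup [seq S p.1 p.2 | p <- ps].

(* [nodes k] lists the retained nodes of level k, and [succ k y v] is the node
   of level k.+1 reached from the retained node y of level k with the control
   v.  The order [ps] in which the pairs (node, control) of a level are
   processed, and the choice between equally near nodes, are arbitrary. *)
Definition pruned_tree (eps : R) (x : 'rV[R]_d) (s : R)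
    (nodes : nat -> seq 'rV[R]_d)
    (succ : nat -> 'rV[R]_d -> 'rV[R]_m -> 'rV[R]_d) : Prop :=
  nodes (grid_index s) = [:: x] /\
  forall k, (grid_index s <= k < N)%N ->
  exists ps : seq ('rV[R]_d * 'rV[R]_m),
  [/\ uniq ps,
      forall y v, (y, v) \in ps <-> y \in nodes k /\ U v,
      nodes k.+1 = retained (succ k) ps &
      forall ps1 y v ps2, ps = ps1 ++ (y, v) :: ps2 ->
      exists2 e, is_correction eps (euler_step s k y v)
                   (retained (succ k) ps1) e
               & succ k y v = euler_step s k y v + e].

Definition pruned_value
    (succ : nat -> 'rV[R]_d -> 'rV[R]_m -> 'rV[R]_d)
    (x : 'rV[R]_d) (s : R) : R :=
  value_along succ x s.

End Scheme.

Lemma is_correction_exists (R : realType) d eps (x : 'rV[R]_d) xs :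
  exists e, is_correction eps x xs e.
Proof.
case: (pselect (exists k, is_argmin x xs k /\ enorm (x - xs`_k) <= eps))
  => [[k [h1 h2]]|h].
  by exists (xs`_k - x); left; exists k.
by exists 0; right.
Qed.

Lemma pruned_level_exists (R : realType) d m eps
    (F : 'rV[R]_d -> 'rV[R]_m -> 'rV[R]_d) ps : uniq ps ->
  exists S, forall ps1 y v ps2, ps = ps1 ++ (y, v) :: ps2 ->
    exists2 e, is_correction eps (F y v) (retained S ps1) e & S y v = F y v + e.
Proof.
elim/last_ind: ps => [_|ps [y v] IH]; first by exists F => -[].
rewrite rcons_uniq => /andP[nin u]; have [S HS] := IH u.
have [e He] := is_correction_exists eps (F y v) (retained S ps).
pose S' a b := if (a, b) == (y, v) then F y v + e else S a b.
have eqS qs : {subset qs <= ps} -> retained S' qs = retained S qs.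
  move=> sub; congr undup; apply/eq_in_map => -[a b] /sub h; rewrite /S' /=.
  by case: eqP => // E; rewrite E (negbTE nin) in h.
exists S' => ps1 a b ps2; case/lastP: ps2 => [|ps2 q].
  rewrite cats1 => /rcons_inj [<- <- <-]; exists e; last by rewrite /S' eqxx.
  by rewrite eqS.
rewrite -rcons_cons -rcons_cat => /rcons_inj [E _].
have [e' h1 h2] := HS _ _ _ _ E; exists e'.
  by rewrite eqS // => z hz; rewrite E mem_cat hz.
rewrite /S'; case: eqP => // E2; move: nin.
by rewrite E -E2 mem_cat inE eqxx orbT.
Qed.

Lemma pruned_tree_exists (R : realType) d m (T : R)
    (f : 'rV[R]_d -> 'rV[R]_m -> R -> 'rV[R]_d) U N eps x s :
  finite_set U ->
  exists nodes succ, pruned_tree T f U N eps x s nodes succ.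
Proof.
move=> /finite_fsetP[X UX]; subst U.
pose n := grid_index T N s.
pose prs (X0 : seq 'rV[R]_d) := [seq (y, v) | y <- undup X0, v <- finmap.enum_fset X].
have up X0 : uniq (prs X0).
  by apply: allpairs_uniq => //; [exact: undup_uniq| move=> [a b] [c e]].
have /choice[S HS] : forall q : nat * seq 'rV[R]_d, exists S,
    forall ps1 y v ps2, prs q.2 = ps1 ++ (y, v) :: ps2 ->
    exists2 e, is_correction eps (euler_step T f N s q.1 y v)
                 (retained S ps1) e
             & S y v = euler_step T f N s q.1 y v + e.
  by move=> q; apply: pruned_level_exists (up _).
pose fix lev j :=
  if j is i.+1 then
    retained (S ((n + i)%N, lev i)) (prs (lev i))
  else [:: x].
exists (fun k => lev (k - n)%N), (fun k => S (k, lev (k - n)%N)).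
split=> [|k /andP[nk _]]; first by rewrite subnn.
exists (prs (lev (k - n)%N)); split => //.
- move=> y v; split=> [/allpairsP[[a b] /= [h1 h2 [-> ->]]]|[h1 h2]].
    by split => //; rewrite -mem_undup.
  by apply/allpairsP; exists (y, v); split => //=; rewrite mem_undup.
- by rewrite subSn //= subnKC.
- exact: (HS (k, lev (k - n)%N)).
Qed.

(* Main.v *)
Require Import Defs.
From HB Require Import structures.
From mathcomp Require Import all_boot all_order all_algebra.
From mathcomp Require Import all_classical all_reals all_analysis.
From mathcomp Require Import ring lra.
Set Implicit Arguments.
Unset Strict Implicit.
Unset Printing Implicit Defensive.
Import Order.TTheory GRing.Theory Num.Theory.
Import numFieldNormedType.Exports.
Local Open Scope classical_set_scope.
Local Open Scope ring_scope.

(* Each pruning correction has norm at most eps <= C dt^2, so comparing the two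
   trajectories of one control, the discrete Gronwall inequality bounds their
   distance by N * eps * e^(Lf T) = O(dt).  The costs then differ by O(dt),
   uniformly in the control, and so do their infima. *)

(** * The Euclidean norm on row vectors *)

Section Enorm.
Variables (R : realType) (d : nat).
Implicit Types (x y : 'rV[R]_d) (c : R).

Lemma enorm_ge0 x : 0 <= enorm x.
Proof. exact: sqrtr_ge0. Qed.

Lemma enorm0 : enorm (0 : 'rV[R]_d) = 0.
Proof. by rewrite /enorm big1 ?sqrtr0// => i _; rewrite mxE expr0n. Qed.

Lemma sqr_enorm x : enorm x ^+ 2 = \sum_(i < d) x 0 i ^+ 2.
Proof. by rewrite sqr_sqrtr// sumr_ge0// => i _; rewrite sqr_ge0. Qed.

Lemma enormZ c x : enorm (c *: x) = `|c| * enorm x.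
Proof.
rewrite /enorm -sqrtr_sqr -sqrtrM ?sqr_ge0// mulr_sumr.
by under eq_bigr do rewrite mxE exprMn.
Qed.

Lemma enormN x : enorm (- x) = enorm x.
Proof. by rewrite -scaleN1r enormZ normrN1 mul1r. Qed.

Lemma enorm_eq0 x : enorm x = 0 -> x = 0.
Proof.
move=> x0; have /eqP := sqr_enorm x.
rewrite x0 expr0n eq_sym psumr_eq0 => [/allP h|i _]; last exact: sqr_ge0.
apply/rowP => i; rewrite mxE; apply/eqP; rewrite -sqrf_eq0.
by apply: (implyP (h i _)); rewrite ?mem_index_enum.
Qed.

(** Cauchy-Schwarz, the ingredient of the triangle inequality below. The degenerate cases come first
    because the main argument cancels the factor [2 * enorm x * enorm y]. *)
Lemma dotmul_le_enorm x y : \sum_(i < d) x 0 i * y 0 i <= enorm x * enorm y.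
Proof.
have [y0|yn0] := eqVneq (enorm y) 0.
  rewrite y0 mulr0 big1// => i _.
  by rewrite (enorm_eq0 y0) mxE mulr0.
have y0 : 0 < enorm y by rewrite lt_def yn0 enorm_ge0.
have [x0|xn0] := eqVneq (enorm x) 0.
  rewrite x0 mul0r big1// => i _.
  by rewrite (enorm_eq0 x0) mxE mul0r.
have x0 : 0 < enorm x by rewrite lt_def xn0 enorm_ge0.
(* Expanded, this sum of squares is [2 * enorm x * enorm y] times the gap in the inequality. *)
have : 0 <= \sum_(i < d) (enorm y * x 0 i - enorm x * y 0 i) ^+ 2.
  by apply: sumr_ge0 => i _; exact: sqr_ge0.
under eq_bigr => i _.
  rewrite (_ : _ ^+ 2 = enorm y ^+ 2 * x 0 i ^+ 2 + enorm x ^+ 2 * y 0 i ^+ 2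
    - (2 * enorm x * enorm y) * (x 0 i * y 0 i)); last by ring.
  over.
rewrite sumrB big_split/= -!mulr_sumr -!sqr_enorm.
rewrite (_ : _ + _ - _ = (2 * enorm x * enorm y) *
  (enorm x * enorm y - \sum_(i < d) x 0 i * y 0 i)); last by ring.
by rewrite pmulr_rge0 ?mulr_gt0// subr_ge0.
Qed.

Lemma ler_enormD x y : enorm (x + y) <= enorm x + enorm y.
Proof.
rewrite -(@ler_pXn2r _ 2)// ?nnegrE ?addr_ge0 ?enorm_ge0// sqr_enorm.
under eq_bigr do rewrite mxE sqrrD.
rewrite !big_split/= -!sqr_enorm sqrrD lerD2r lerD2l mulr2n.
by apply: lerD; exact: dotmul_le_enorm.
Qed.

End Enorm.

(** * Discrete Gronwall inequality *)

(** In the inductive step the new [b] is at most [b * a ^+ i.+1], as [1 <= a]. This form is coarser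
    than the geometric sum but involves no division by [a - 1], which is 0 when the Lipschitz
    constant is. *)
Lemma discrete_gronwall (R : realDomainType) (e : nat -> R) (a b : R) J :
  1 <= a -> 0 <= b -> e 0%N <= 0 ->
  (forall i, (i < J)%N -> e i.+1 <= a * e i + b) ->
  forall i, (i <= J)%N -> e i <= i%:R * b * a ^+ i.
Proof.
move=> a1 b0 e0 h; elim=> [_|i IH iJ]; first by rewrite !mul0r.
apply: le_trans (h _ iJ) _.
rewrite -natr1 mulrDl mul1r mulrDl lerD//.
  by rewrite exprS mulrCA ler_wpM2l ?IH ?(ltnW iJ)// (le_trans ler01).
by rewrite ler_peMr// exprn_ege1.
Qed.

(** * Infima of uniformly close functions *)

Section InfImage.
Variables (R : realType) (W : Type) (A : set W).
Implicit Types (a b : W -> R) (D : R).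

Lemma le_inf_image a b D : (forall u, A u -> a u <= b u + D) ->
  has_inf (a @` A) -> inf (a @` A) - D <= inf (b @` A).
Proof.
move=> h [[_ [u Au _]] lb]; apply: lb_le_inf; first by exists (b u); exists u.
move=> _ [v Av <-]; rewrite lerBlDr (le_trans _ (h v Av))//.
by apply: ge_inf => //; exists v.
Qed.

(** A lower bound [c] of one image yields the lower bound [c - D] of the other, so both infima exist
    or neither does. *)
Lemma has_inf_image a b D : (forall u, A u -> a u <= b u + D) ->
  has_inf (a @` A) -> has_inf (b @` A).
Proof.
move=> h [[_ [u Au _]] [c lb]]; split; first by exists (b u); exists u.
exists (c - D) => _ [v Av <-]; rewrite lerBlDr (le_trans _ (h v Av))//.
by apply: lb; exists v.
Qed.

(* If one image has no infimum then neither has the other, and [inf] takes the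
   junk value 0 on both. *)
Lemma dist_inf_image a b D : 0 <= D ->
  (forall u, A u -> `|a u - b u| <= D) ->
  `|inf (a @` A) - inf (b @` A)| <= D.
Proof.
move=> D0 h.
have ab u : A u -> a u <= b u + D by move=> /h; rewrite ler_distlC => /andP[]; lra.
have ba u : A u -> b u <= a u + D by move=> /h; rewrite ler_distlC => /andP[]; lra.
have [ia|nia] := pselect (has_inf (a @` A)).
  have ib := has_inf_image ab ia.
  have := le_inf_image ab ia; have := le_inf_image ba ib.
  by rewrite ler_distlC; lra.
have nib : ~ has_inf (b @` A) by move=> /(has_inf_image ba).
by rewrite !inf_out// subrr normr0.
Qed.

End InfImage.

(** * The uniform time grid *)

Section TimeGrid.
Variables (R : realType) (T : R) (N : nat).
Hypotheses (T0 : 0 < T) (N0 : (0 < N)%N).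
Local Notation dt := (time_step T N).
Local Notation t_ := (grid T N).

Lemma time_step_gt0 : 0 < dt.
Proof. by rewrite divr_gt0// ltr0n. Qed.

Lemma gridN : t_ N = T.
Proof. by rewrite /grid /time_step mulrC divfK// pnatr_eq0 -lt0n. Qed.

Lemma gridS k : t_ k.+1 = t_ k + dt.
Proof. by rewrite /grid -natr1 mulrDl mul1r. Qed.

Lemma le_grid k l : (k <= l)%N -> t_ k <= t_ l.
Proof. by move=> kl; rewrite ler_pM2r ?time_step_gt0// ler_nat. Qed.

Lemma grid_index_lt s : 0 <= s < T -> (grid_index T N s < N)%N.
Proof.
move=> /andP[s0 sT]; rewrite truncn_lt_nat ?divr_ge0 ?ler0n ?(ltW T0)//.
by rewrite ltr_pdivrMr ?time_step_gt0// -/(t_ N) gridN.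
Qed.

End TimeGrid.

(** * Distance between the Euler and the pruned trajectories *)

Section PrunedTree.
Variables (R : realType) (d m : nat) (T : R).
Variable f : 'rV[R]_d -> 'rV[R]_m -> R -> 'rV[R]_d.
Variables (U : set 'rV[R]_m) (N : nat).
Variables (eps : R) (x : 'rV[R]_d) (s : R).
Variable nodes : nat -> seq 'rV[R]_d.
Variable succ : nat -> 'rV[R]_d -> 'rV[R]_m -> 'rV[R]_d.
Hypotheses (T0 : 0 < T) (N0 : (0 < N)%N) (eps0 : 0 <= eps).
Hypotheses (s0 : 0 <= s) (sT : s < T).
Hypothesis tree : pruned_tree T f U N eps x s nodes succ.
Local Notation dt := (time_step T N).
Local Notation t_ := (grid T N).
Local Notation n := (grid_index T N s).
Local Notation y_ := (trajectory T N (euler_step T f N s) x s).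
Local Notation eta_ := (trajectory T N succ x s).

Lemma is_correction_le (y : 'rV[R]_d) xs e : is_correction eps y xs e -> enorm e <= eps.
Proof.
case=> [[k [_ h ->]]|[_ ->]]; last by rewrite enorm0.
by rewrite -opprB enormN.
Qed.

(** All that the estimate uses of a pruning step; the processing order and the choice of the nearest
    node disappear here. *)
Lemma pruned_tree_step k y v : (n <= k < N)%N -> y \in nodes k -> U v ->
  succ k y v \in nodes k.+1 /\
  enorm (succ k y v - euler_step T f N s k y v) <= eps.
Proof.
move=> hk hy hv; have [ps [_ psE nE hps]] := tree.2 k hk.
have hyv : (y, v) \in ps by apply/psE.
split.
  by rewrite nE mem_undup; apply/mapP; exists (y, v).
have [ps1 [ps2 psD]] : exists ps1 ps2, ps = ps1 ++ (y, v) :: ps2.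
  by case/splitPr: hyv => ps1 ps2; exists ps1, ps2.
have [e he ->] := hps _ _ _ _ psD.
by rewrite addrC addKr (is_correction_le he).
Qed.

Lemma trajectoryS F (u : nat -> 'rV[R]_m) k : (n <= k)%N ->
  trajectory T N F x s u k.+1 = F k (trajectory T N F x s u k) (u k).
Proof. by move=> nk; rewrite /trajectory subSn//= subnKC. Qed.

(** The pruning error is controlled only at retained nodes, so the pruned trajectory must be known
    to stay among them. *)
Lemma trajectory_node u k : controls T U N s u -> (n <= k <= N)%N ->
  eta_ u k \in nodes k.
Proof.
move=> hu /andP[nk]; rewrite -(subnKC nk); elim: (k - n)%N => [|i IH] iN.
  by rewrite addn0 tree.1 /trajectory subnn inE.
rewrite addnS in iN *; rewrite trajectoryS ?leq_addr//.
have hi : (n <= n + i < N)%N by rewrite leq_addr.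
exact: (pruned_tree_step hi (IH (ltnW iN)) (hu _ hi)).1.
Qed.

Variable Lf : R.
Hypothesis lipf : forall y z v t, U v -> 0 <= t <= T ->
  enorm (f y v t - f z v t) <= Lf * enorm (y - z).

(** The absolute value is taken because [Lf] comes without a sign; it makes the factor at least 1,
    as Gronwall requires. *)
Lemma euler_step_lip k y z v : (n <= k < N)%N -> U v ->
  enorm (euler_step T f N s k y v - euler_step T f N s k z v)
    <= (1 + dt * `|Lf|) * enorm (y - z).
Proof.
move=> /andP[nk kN] Uv.
have dt0 := time_step_gt0 T0 N0.
(* One bound serves both branches of [euler_step]: the shortened first step, taken at time [s], also
   has length at most [dt], since [t_ n <= s]. *)
suff main h t : 0 <= h <= dt -> 0 <= t <= T ->
    enorm (y + h *: f y v t - (z + h *: f z v t))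
      <= (1 + dt * `|Lf|) * enorm (y - z).
  rewrite /euler_step; case: eqP => [->|_].
    have /andP[h1 h2] := grid_indexP dt0 s0.
    apply: main; last by rewrite s0 ltW.
    by rewrite subr_ge0 (ltW h2) lerBlDr gridS addrC lerD2l.
  apply: main; first by rewrite lexx ltW.
  have -> : t_ k <= T by rewrite -[leRHS](gridN T N0) le_grid// ltnW.
  by rewrite andbT mulr_ge0// ltW.
move=> /andP[h0 hdt] ht.
rewrite opprD addrACA -scalerBr (le_trans (ler_enormD _ _))//.
rewrite mulrDl mul1r lerD2l enormZ (ger0_norm h0) -mulrA ler_pM ?enorm_ge0//.
by rewrite (le_trans (lipf _ _ Uv ht))// ler_wpM2r ?enorm_ge0// ler_norm.
Qed.

Lemma dist_trajectory u k : controls T U N s u -> (n <= k <= N)%N ->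
  enorm (y_ u k - eta_ u k) <= N%:R * eps * expR (`|Lf| * T).
Proof.
move=> hu /andP[nk kN].
have dt0 := time_step_gt0 T0 N0.
(* The error is reindexed by the number of steps from the root, where both trajectories equal
   [x]. *)
pose e i := enorm (y_ u (n + i)%N - eta_ u (n + i)%N).
have a1 : 1 <= 1 + dt * `|Lf| by rewrite lerDl mulr_ge0// ltW.
have G : e (k - n)%N <= (k - n)%:R * eps * (1 + dt * `|Lf|) ^+ (k - n).
  apply: (@discrete_gronwall _ e _ _ (k - n)) => //.
    by rewrite /e addn0 /trajectory subnn/= subrr enorm0.
  move=> i ik; rewrite /e addnS !trajectoryS ?leq_addr//.
  have hi : (n <= n + i < N)%N.
    by rewrite leq_addr (leq_trans _ kN)// -ltn_subRL.
  have Ui := hu _ hi.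
  have hnode : eta_ u (n + i)%N \in nodes (n + i)%N.
    by apply: trajectory_node => //; case/andP: hi => -> /ltnW.
  have [_ hs] := pruned_tree_step hi hnode Ui.
  set E := euler_step T f N s (n + i)%N.
  (* Insert the exact Euler step from the pruned node: one difference is propagated by the Lipschitz
     bound, the other is the pruning correction. *)
  rewrite -(subrKA (E (eta_ u (n + i)%N) (u (n + i)%N))).
  rewrite (le_trans (ler_enormD _ _))// lerD ?euler_step_lip//.
  by rewrite -enormN opprB.
rewrite -{1 2}(subnKC nk) (le_trans G)//.
have kN' : (k - n <= N)%N by rewrite (leq_trans _ kN)// leq_subr.
rewrite ler_pM ?mulr_ge0 ?exprn_ge0 ?(le_trans ler01 a1)//.
  by rewrite ler_wpM2r// ler_nat.
rewrite (le_trans (ler_weXn2l a1 kN'))//.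
(* With [N * dt = T], the bound is the [N]-th power of [1 + z <= expR z] at [z = dt * |Lf|]. *)
rewrite (_ : `|Lf| * T = N%:R * (dt * `|Lf|)); last first.
  by rewrite mulrA -[_ * dt]/(t_ N) gridN// mulrC.
by rewrite expRM_natl lerXn2r ?expR_ge1Dx ?nnegrE ?expR_ge0 ?(le_trans ler01 a1).
Qed.

End PrunedTree.

(** * Stability of the cost under perturbation of the trajectory *)

(** Discount factors are at most 1, so each of at most [N] running terms contributes
    [dt * |LL| * D], together [T * |LL| * D], and the final cost adds [|Lg| * D]. *)
Lemma dist_cost (R : realType) d m (T lambda : R)
    (L : 'rV[R]_d -> 'rV[R]_m -> R -> R) (g : 'rV[R]_d -> R)
    (U : set 'rV[R]_m) N LL Lg D x s y z u :
  0 < T -> (0 < N)%N -> 0 <= lambda -> 0 <= s < T ->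
  (forall x y u s, U u -> 0 <= s <= T ->
    `|L x u s - L y u s| <= LL * enorm (x - y)) ->
  (forall x y, `|g x - g y| <= Lg * enorm (x - y)) ->
  controls T U N s u ->
  (forall k, (grid_index T N s < k <= N)%N -> enorm (y k - z k) <= D) ->
  `|cost T lambda L g N x s y u - cost T lambda L g N x s z u|
    <= (T * `|LL| + `|Lg|) * D.
Proof.
move=> T0 N0 lambda0 /andP[s0 sT] lipL lipg hu hD.
have dt0 := time_step_gt0 T0 N0.
have nN : (grid_index T N s < N)%N by rewrite grid_index_lt// s0.
(* Since [n < N], level [N] is one of the levels compared, so [D] dominates a norm. *)
have D0 : 0 <= D by rewrite (le_trans (enorm_ge0 _) (hD N _))// nN leqnn.
have disc t : s <= t -> expR (- lambda * (t - s)) <= 1.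
  by move=> st; rewrite expR_le1 mulNr oppr_le0 mulr_ge0// subr_ge0.
have lipD c a b w K : a <= K * enorm (b - c :> 'rV[R]_d) ->
    enorm (b - c) <= D -> 0 <= a -> 0 <= w <= 1 -> a * w <= `|K| * D.
  move=> aK bcD a0 /andP[w0 w1].
  apply: (@le_trans _ _ a); first by rewrite ler_piMr.
  apply: (le_trans aK); apply: (@le_trans _ _ (`|K| * enorm (b - c))).
    by rewrite ler_wpM2r ?enorm_ge0// ler_norm.
  by rewrite ler_wpM2l.
rewrite /cost; set n := grid_index T N s in hD nN *.
(* The first running term is evaluated at [x] and [s] in both costs and cancels. *)
have rearr (a b c b' c' : R) : a + b + c - (a + b' + c') = (b - b') + (c - c').
  by ring.
rewrite rearr -mulrBr -sumrB -mulrBl.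
rewrite (le_trans (ler_normD _ _))// [leRHS]mulrDl lerD//; last first.
  rewrite normrM (ger0_norm (expR_ge0 _)).
  apply: (lipD _ _ _ _ _ (lipg _ _)) => //; first by rewrite hD ?nN/=.
  by rewrite expR_ge0 disc ?(ltW sT).
rewrite normrM (gtr0_norm dt0).
apply: (@le_trans _ _ (time_step T N * (N%:R * (`|LL| * D)))); last first.
  by rewrite !mulrA (mulrC (time_step T N)) -[_ * time_step T N]/(grid T N N) gridN.
rewrite ler_pM2l// (le_trans (ler_norm_sum _ _ _))//.
apply: (@le_trans _ _ (\sum_(n.+1 <= k < N) `|LL| * D)); last first.
  rewrite sumr_const_nat -[leLHS]mulr_natl ler_wpM2r ?mulr_ge0// ler_nat.
  exact: leq_subr.
rewrite big_nat [leRHS]big_nat; apply: ler_sum => k /andP[nk kN].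
have st : s <= grid T N k.
  have /andP[_ /ltW h] := grid_indexP dt0 s0.
  by rewrite (le_trans h)// le_grid.
have tT : grid T N k <= T by rewrite -[leRHS](gridN T N0) le_grid// ltnW.
rewrite -mulrBl normrM (ger0_norm (expR_ge0 _)).
apply: (lipD _ _ _ _ _ (lipL _ _ _ _ _ _)) => //; last by rewrite expR_ge0 disc.
- by apply: hu; rewrite kN andbT ltnW.
- by rewrite tT (le_trans s0).
- by rewrite hD// nk ltnW.
Qed.

(** * The error of the pruned value function *)

Theorem proposition3p7 (R : realType) (d m : nat) (T lambda : R)
  (f : 'rV[R]_d -> 'rV[R]_m -> R -> 'rV[R]_d)
  (L : 'rV[R]_d -> 'rV[R]_m -> R -> R)
  (g : 'rV[R]_d -> R)
  (U : set 'rV[R]_m)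
  (Mf ML Mg Lf LL Lg C : R) :
  (0 < d)%N -> (0 < m)%N -> 0 < T -> 0 <= lambda ->
  finite_set U -> U !=set0 ->
  {within [set p : 'rV[R]_d * 'rV[R]_m * R | p.2 \in `[0, T]],
    continuous (fun p => f p.1.1 p.1.2 p.2)} ->
  {within [set p : 'rV[R]_d * 'rV[R]_m * R | p.2 \in `[0, T]],
    continuous (fun p => L p.1.1 p.1.2 p.2)} ->
  continuous g ->
  (forall x u s, U u -> 0 <= s <= T -> enorm (f x u s) <= Mf) ->
  (forall x u s, U u -> 0 <= s <= T -> `|L x u s| <= ML) ->
  (forall x, `|g x| <= Mg) ->
  (forall x y u s, U u -> 0 <= s <= T ->
    enorm (f x u s - f y u s) <= Lf * enorm (x - y)) ->
  (forall x y u s, U u -> 0 <= s <= T ->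
    `|L x u s - L y u s| <= LL * enorm (x - y)) ->
  (forall x y, `|g x - g y| <= Lg * enorm (x - y)) ->
  exists Cstar : R,
    forall (N : nat) (eps : R), (0 < N)%N ->
    0 < eps -> eps <= C * time_step T N ^+ 2 ->
    forall (x : 'rV[R]_d) (t : R), 0 <= t <= T ->
    forall (nodes : nat -> seq 'rV[R]_d)
      (succ : nat -> 'rV[R]_d -> 'rV[R]_m -> 'rV[R]_d),
    pruned_tree T f U N eps x t nodes succ ->
    `|value T lambda f L g U N x t - pruned_value T lambda L g U N succ x t|
      <= Cstar * time_step T N.
Proof.
move=> _ _ T0 lambda0 _ _ _ _ _ _ _ _ lipf lipL lipg.
(* From [eps <= C * dt ^ 2] and [N * dt = T] one gets [N * eps <= |C| * T * dt], so [B * dt] bounds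
   the distance of the trajectories, with [B] free of [N] and [eps]. *)
pose B := `|C| * T * expR (`|Lf| * T).
have B0 : 0 <= B by rewrite !mulr_ge0 ?expR_ge0// ltW.
have K0 : 0 <= (T * `|LL| + `|Lg|) * B.
  by rewrite mulr_ge0// addr_ge0// mulr_ge0// ltW.
exists ((T * `|LL| + `|Lg|) * B) => N eps N0 eps0 epsC x t /andP[t0 tT].
move=> nodes succ tree; have dt0 := time_step_gt0 T0 N0.
(* At [t = T] both values are [g x]; otherwise they are infima over the same controls. *)
rewrite /value /pruned_value /value_along; case: eqP => [_|/eqP tneT].
  by rewrite subrr normr0 mulr_ge0// ltW.
have ltT : t < T by rewrite lt_neqAle tneT.
apply: dist_inf_image => [|u hu]; first by rewrite mulr_ge0// ltW.
rewrite -mulrA; apply: (dist_cost _ _ _ _ _ lipL lipg hu) => //.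
  by rewrite t0.
move=> k /andP[nk kN].
have hk : (grid_index T N t <= k <= N)%N by rewrite ltnW.
apply: (le_trans (dist_trajectory T0 N0 (ltW eps0) t0 ltT tree lipf hu hk)).
rewrite /B [leRHS]mulrAC ler_wpM2r ?expR_ge0//.
apply: (@le_trans _ _ (N%:R * (`|C| * time_step T N ^+ 2))).
  rewrite ler_wpM2l// (le_trans epsC)// ler_wpM2r ?ler_norm//.
  by rewrite exprn_ge0// ltW.
by rewrite mulrCA expr2 (mulrA N%:R) -[N%:R * _]/(grid T N N) gridN// mulrA.
Qed.
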